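(* Let $G$ be a finite graph (loops and multiple edges allowed) and let $h(G)$ denote the number of Hamiltonian cycles of $G$. Then: (1) if $e$ is an edge of $G$ with two distinct endpoints $u\neq v$, then $h(G)=h(G-e)+h(G/e)-h(G-u)-h(G-v)$; (2) if $G=G_1+G_2$ is the disjoint union of two nonempty graphs $G_1,G_2$, then $h(G)=0$; (3) for every $n\geq 0$, $h(K_1^n)=n$.
   Context: A graph is a triple $G=(V,E,\varphi)$ with $V,E$ finite sets and $\varphi$ mapping each edge to an unordered pair $\{u,v\}$ of vertices (possibly $u=v$, a loop); graphs are nonempty unless stated otherwise. The degree of a vertex counts loops twice. A cycle is a walk $v_0e_1v_1\dots e_nv_n$ with $n\geq 1$ in which consecutive terms are incident and all vertices and edges are distinct except $v_0=v_n$, regarded as a subgraph (so a loop is a cycle of length 1 and two parallel edges form a cycle of length 2); cycles are counted as subgraphs. A Hamiltonian cycle is a cycle that is a spanning subgraph (contains all vertices). $K_1^n$ is the graph with one vertex and $n$ loops. For an edge $e$ with endpoints $u\neq v$: $G-e$ deletes $e$; $G/e$ contracts $e$, i.e. deletes $e$ and identifies $u$ and $v$ into a single vertex (other edges between $u$ and $v$become loops); $G-u$ deletes the vertex $u$ together with all edges incident with it. *)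

(* Defs.v *)
From HB Require Import structures.
From mathcomp Require Import all_boot all_order all_algebra.
From mathcomp Require Import boolp.

Set Implicit Arguments.
Unset Strict Implicit.
Unset Printing Implicit Defensive.

(* [vert] may be empty; nonemptiness is an explicit hypothesis
   where it matters. *)
Record mgraph := MGraph {
  vert : finType;
  edge : finType;
  ends : edge -> {set vert};
  ends_pair : forall e : edge, exists x y : vert, ends e = [set x; y]
}.

Definition nonempty_graph (G : mgraph) : Prop := 0 < #|vert G|.

(* A candidate subgraph is a pair (vertex set, edge set). *)
Definition is_subgraph (G : mgraph) (H : {set vert G} * {set edge G}) : Prop :=
  forall e : edge G, e \in H.2 -> ends e \subset H.1.

(* The walk v_0 e_1 v_1 ... e_n v_n is encoded as the vertex v_0 together with
   the sequence (e_1, v_1), ..., (e_n, v_n). *)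
Fixpoint is_walk (G : mgraph) (x : vert G) (p : seq (edge G * vert G)) : bool :=
  if p is (e, y) :: p' then [&& x \in ends e, y \in ends e & is_walk y p']
  else true.

(* v_1, ..., v_n are distinct and v_0 = v_n.  When n = 1 incidence alone does
   not make e_1 a loop; the subgraph condition does. *)
Definition is_cycle (G : mgraph) (H : {set vert G} * {set edge G}) : Prop :=
  is_subgraph H /\
  exists (x : vert G) (p : seq (edge G * vert G)),
    [/\ 1 <= size p, is_walk x p & last x (unzip2 p) = x] /\
    [/\ uniq (unzip1 p), uniq (unzip2 p),
        H.1 = [set y in unzip2 p] & H.2 = [set e in unzip1 p]].

Definition is_hamiltonian_cycle (G : mgraph)
    (H : {set vert G} * {set edge G}) : Prop :=
  is_cycle H /\ H.1 = [set: vert G].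

Definition num_hamiltonian (G : mgraph) : nat :=
  #|[set H : {set vert G} * {set edge G} | `[< is_hamiltonian_cycle H >]]|.

Section Operations.
Variable G : mgraph.

Section DeleteEdge.
Variable e : edge G.

Definition del_edge_ends (f : {f : edge G | f != e}) : {set vert G} :=
  ends (val f).

Lemma del_edge_pair f : exists x y, del_edge_ends f = [set x; y].
Proof. exact: ends_pair. Qed.

Definition del_edge : mgraph := MGraph del_edge_pair.
End DeleteEdge.

Section Contract.
Variable e : edge G.

(* [None] is the vertex obtained by identifying the endpoints of [e]. *)
Definition contract_vertex (x : vert G) : option {x : vert G | x \notin ends e} :=
  insub x.

Definition contract_ends (f : {f : edge G | f != e}) :
  {set option {x : vert G | x \notin ends e}} :=
  contract_vertex @: ends (val f).

Lemma contract_pair f : exists x y, contract_ends f = [set x; y].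
Proof.
rewrite /contract_ends; have [x [y ->]] := ends_pair (val f).
by exists (contract_vertex x), (contract_vertex y); rewrite imsetU1 imset_set1.
Qed.

Definition contract_edge : mgraph := MGraph contract_pair.
End Contract.

Section DeleteVertex.
Variable u : vert G.

Definition del_vertex_ends (f : {f : edge G | u \notin ends f}) :
  {set {x : vert G | x != u}} := [set x | val x \in ends (val f)].

Lemma del_vertex_pair f : exists x y, del_vertex_ends f = [set x; y].
Proof.
case: f => f /= uf; have [x [y E]] := ends_pair f.
have xu : x != u by apply: contraNneq uf => <-; rewrite E set21.
have yu : y != u by apply: contraNneq uf => <-; rewrite E set22.
exists (Sub x xu), (Sub y yu); apply/setP => z.
by rewrite !inE /= E !inE -!val_eqE.
Qed.

Definition del_vertex : mgraph := MGraph del_vertex_pair.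
End DeleteVertex.
End Operations.

Section DisjointUnion.
Variables G1 G2 : mgraph.

Definition disjoint_union_ends (f : edge G1 + edge G2) :
  {set vert G1 + vert G2} :=
  match f with
  | inl f1 => [set inl x | x in ends f1]
  | inr f2 => [set inr x | x in ends f2]
  end.

Lemma disjoint_union_pair f : exists x y, disjoint_union_ends f = [set x; y].
Proof.
case: f => f /=; have [x [y ->]] := ends_pair f.
- by exists (inl x), (inl y); rewrite imsetU1 imset_set1.
- by exists (inr x), (inr y); rewrite imsetU1 imset_set1.
Qed.

Definition disjoint_union : mgraph := MGraph disjoint_union_pair.
End DisjointUnion.

Lemma bouquet_pair n (i : 'I_n) : exists x y : unit, [set tt] = [set x; y].
Proof. by exists tt, tt; rewrite setUid. Qed.

(* K_1^n *)
Definition bouquet (n : nat) : mgraph :=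
  @MGraph unit 'I_n (fun=> [set tt]) (@bouquet_pair n).

(* Main.v *)
(* An edge set F is the edge set of a Hamiltonian cycle iff every vertex has
   degree 2 in F (loops count twice) and F connects all the vertices.  If
   e = uv is not in F, the degree of the contracted vertex of G/e in F is
   deg u + deg v, so a Hamiltonian cycle F of G/e has degrees (1,1), (0,2) or
   (2,0) at (u,v): these are the cases where F + e is a Hamiltonian cycle of G,
   F is one of G - u, and F is one of G - v. *)

Require Import Defs.
From HB Require Import structures.
From mathcomp Require Import all_boot all_order all_algebra.
From mathcomp Require Import boolp.
From mathcomp Require Import zify.
Import GRing.Theory.

Set Implicit Arguments.
Unset Strict Implicit.
Unset Printing Implicit Defensive.

(** * Degrees and connectivity of an edge set under an arbitrary incidence map *)

Section Incidence.
Variables (V E : finType) (en : E -> {set V}).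
Implicit Types (F : {set E}) (A : pred V).

(** The second summand counts a loop for the second time. *)
Definition mult (f : E) (x : V) : nat := (x \in en f) + (en f == [set x]).

Definition deg F x : nat := \sum_(f in F) mult f x.

Definition saturated F A : Prop :=
  forall f, f \in F -> forall x y, x \in en f -> y \in en f -> A x -> A y.

(** Connectivity without paths: saturated sets are the unions of components, and a nonempty one has
    to be everything. *)
Definition spanning_connected F : Prop :=
  forall A, saturated F A -> forall x y, A x -> A y.

(** [0 < #|V|] excludes the empty vertex set, where the empty edge set would qualify although there
    is no cycle. The incidence map is a parameter so that one edge set can be tested in [G], in a
    contraction and in a vertex deletion. *)
Definition ham F : Prop :=
  [/\ 0 < #|V|, forall x, deg F x = 2 & spanning_connected F].

Lemma multE f a b x : en f = [set a; b] -> mult f x = (a == x) + (b == x).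
Proof.
rewrite /mult => ->; rewrite !inE ![x == _]eq_sym.
have -> : ([set a; b] == [set x]) = (a == x) && (b == x).
  apply/eqP/andP => [E1|[/eqP -> /eqP ->]]; last by rewrite setUid.
  by move/setP: E1 => E1; split; rewrite -in_set1 -E1 !inE eqxx ?orbT.
by case: eqP; case: eqP.
Qed.

Lemma mult_eq0 f x : (mult f x == 0) = (x \notin en f).
Proof.
rewrite /mult addn_eq0 eqb0; case: (boolP (x \in en f)) => //= xf.
by rewrite eqb0; apply: contraNneq xf => ->; rewrite inE.
Qed.

Lemma deg_eq0 F x : deg F x = 0 <-> forall f, f \in F -> x \notin en f.
Proof.
rewrite /deg; split=> [/eqP|H].
  by rewrite sum_nat_eq0 => /forall_inP H f /H; rewrite mult_eq0.
by apply: big1 => f /H; rewrite -mult_eq0 => /eqP.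
Qed.

Lemma degU1 F e x : e \notin F -> deg (e |: F) x = mult e x + deg F x.
Proof. by move=> eF; rewrite /deg big_setU1. Qed.

Lemma deg_seq F (s : seq E) x : uniq s -> {subset s <= F} ->
  deg F x = \sum_(f <- s) mult f x + \sum_(f in F | f \notin s) mult f x.
Proof.
move=> us sF; rewrite /deg (bigID (mem s)) /= big_uniq //=; congr (_ + _).
by apply: eq_bigl => f; rewrite andbC; case: (boolP (f \in s)) => // /sF.
Qed.

End Incidence.

(** * Transfer from a subtype of edges to all edges *)

Section SubEdges.
Variables (V E : finType) (en : E -> {set V}) (P : pred E).

Lemma ham_val (F : {set {f | P f}}) :
  ham (fun f => en (val f)) F <-> ham en (val @: F).
Proof.
have dE x : deg en (val @: F) x = deg (fun f => en (val f)) F x.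
  by rewrite /deg big_imset //= => f g _ _; apply: val_inj.
have sE A : saturated en (val @: F) A <-> saturated (fun f => en (val f)) F A.
  split=> H f; first by move=> fF; apply: H; apply: imset_f.
  by case/imsetP=> g gF ->; apply: H.
by split=> -[V0 d c]; split=> // [x|A /sE]; try exact: c; rewrite -?dE // dE.
Qed.

(** Rewrites counts over different edge subtypes as sums over the edge sets of one type, so that
    they can be compared term by term. *)
Lemma card_ham_val :
  #|[set F : {set {f | P f}} | `[< ham (fun f => en (val f)) F >]]|
  = \sum_(F : {set E}) (F \subset P) && `[< ham en F >].
Proof.
rewrite -(card_imset _ (imset_inj val_inj)) -sum1_card.
rewrite [LHS]big_mkcond /=; apply: eq_bigr => F _.
suff -> : (F \in (fun B : {set {f | P f}} => val @: B) @:
    [set F | `[< ham (fun f => en (val f)) F >]])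
    = (F \subset P) && `[< ham en F >] by case: ifP.
apply/imsetP/andP => [[F']|[/subsetP sF /asboolP hF]].
  rewrite inE => /asboolP/ham_val hF ->; split; last exact/asboolP.
  by apply/subsetP => f /imsetP[g _ ->]; apply: (valP g).
have EF : F = val @: [set g : {f | P f} | val g \in F].
  apply/setP => f; apply/idP/imsetP => [fF|[g]]; last by rewrite inE => ? ->.
  by exists (Sub f (sF f fF)); rewrite ?inE.
exists [set g : {f | P f} | val g \in F] => //; rewrite inE.
by apply/asboolP/ham_val; rewrite -EF.
Qed.
End SubEdges.

(** * Hamiltonian cycles as connected spanning 2-regular edge sets *)

Section Characterization.
Variable G : mgraph.
Implicit Types (x y z : vert G) (p : seq (edge G * vert G)) (F : {set edge G}).
Notation en := (@ends G).

(** Incidence alone lets a step along a non-loop edge stay at the same vertex. Here each edge has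
    exactly the two consecutive vertices as ends, so degrees can be read off the walk. *)
Fixpoint exact_walk x p : bool :=
  if p is (e, y) :: p' then (ends e == [set x; y]) && exact_walk y p' else true.

Lemma exact_walk_rcons x p e y :
  exact_walk x (rcons p (e, y)) =
  exact_walk x p && (ends e == [set last x (unzip2 p); y]).
Proof.
by elim: p x => [|[f z] p IH] x /=; rewrite ?andbT // IH andbA.
Qed.

Lemma exact_walk_is_walk x p : exact_walk x p -> is_walk x p.
Proof.
elim: p x => [|[f z] p IH] x //= /andP[/eqP -> /IH ->].
by rewrite !inE !eqxx orbT.
Qed.

Lemma ends_pair_of (f : edge G) x y :
  x \in ends f -> y \in ends f -> x != y -> ends f = [set x; y].
Proof.
have [a [b ->]] := ends_pair f; rewrite !inE.
by case/orP=> /eqP-> /orP[] /eqP->; rewrite ?eqxx // => _; rewrite setUC.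
Qed.

Lemma ends_pair_in (f : edge G) x :
  x \in ends f -> exists y, ends f = [set x; y].
Proof.
have [a [b ->]] := ends_pair f; rewrite !inE.
by case/orP=> /eqP->; [exists b | exists a; rewrite setUC].
Qed.

Lemma is_walk_exact x p :
  is_walk x p -> uniq (x :: unzip2 p) -> exact_walk x p.
Proof.
elim: p x => [|[f z] p IH] x //= /and3P[xf zf w] /andP[+ /andP[zp up]].
rewrite inE negb_or => /andP[xz _]; rewrite IH ?andbT //= ?zp //.
exact/eqP/ends_pair_of.
Qed.

(** Each step contributes one at its start and one at its end; [belast] lists the starts. *)
Lemma sum_mult_walk x p y : exact_walk x p ->
  \sum_(f <- unzip1 p) mult en f y
  = count_mem y (belast x (unzip2 p)) + count_mem y (unzip2 p).
Proof.
elim: p x => [|[f z] p IH] x /=; first by rewrite big_nil.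
by case/andP=> /eqP fE w; rewrite big_cons (IH _ w) (multE _ fE) addnACA.
Qed.

Lemma count_belast x p y :
  count_mem y (belast x (unzip2 p)) + (last x (unzip2 p) == y)
  = (x == y) + count_mem y (unzip2 p).
Proof.
have := congr1 (count_mem y) (lastI x (unzip2 p)).
by rewrite -cats1 count_cat /= addn0.
Qed.

Lemma walk_saturated F A x p : exact_walk x p -> saturated en F A ->
  {subset unzip1 p <= F} -> forall y, y \in unzip2 p -> A x = A y.
Proof.
elim: p x => [|[f z] p IH] x //= /andP[/eqP fE w] sA sF y.
have -> : A x = A z.
  have fF : f \in F by apply: sF; rewrite mem_head.
  by apply/idP/idP; apply: (sA f fF); rewrite fE ?set21 ?set22.
rewrite inE => /orP[/eqP-> //|]; apply: IH => // g gp.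
by apply: sF; rewrite inE gp orbT.
Qed.

Lemma cycle_exact_walk x p (H : {set vert G} * {set edge G}) :
  is_subgraph H -> 0 < size p -> is_walk x p -> last x (unzip2 p) = x ->
  uniq (unzip2 p) -> H.1 = [set y in unzip2 p] -> H.2 = [set e in unzip1 p] ->
  exact_walk x p.
Proof.
case: p => [|[f y] p] //= sub _ /and3P[xf yf w] lE /andP[yp up] H1 H2.
rewrite (is_walk_exact w) /= ?yp // andbT; apply/eqP.
case: p => [|[g z] p] /= in lE yp up H1 H2 w *; last first.
  apply: ends_pair_of => //; apply: contraNneq yp => <-.
  by rewrite -{1}lE mem_last.
have := sub f; rewrite H2 H1 !inE eqxx => /(_ isT) /subsetP s.
rewrite lE setUid; apply/setP => t; rewrite inE.
by apply/idP/eqP => [/s|->//]; rewrite !inE lE => /eqP.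
Qed.

(** Every vertex is the start of exactly one step and the end of exactly one, hence has degree 2;
    the walk carries a saturated set to all vertices. *)
Lemma hamiltonian_ham (H : {set vert G} * {set edge G}) :
  is_hamiltonian_cycle H -> H.1 = setT /\ ham en H.2.
Proof.
case=> -[sub [x [p [[sp w lE] [u1 u2 H1 H2]]]]] HT; split=> //.
have ew := cycle_exact_walk sub sp w lE u2 H1 H2.
have allp y : y \in unzip2 p by have := in_setT y; rewrite -HT H1 inE.
split=> [|y|A sA y z]; first by apply/card_gt0P; exists x.
  rewrite H2 (@deg_seq _ _ _ _ (unzip1 p)) //; last by move=> f; rewrite inE.
  rewrite (sum_mult_walk _ ew) [X in _ + X]big1 => [|f]; last first.
    by rewrite inE; case: (f \in _).
  have := count_belast x p y; rewrite lE (count_uniq_mem _ u2) allp; lia.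
have sub1 : {subset unzip1 p <= H.2} by move=> f; rewrite H2 inE.
have pA := walk_saturated ew sA sub1.
by rewrite -(pA y) // -(pA z).
Qed.

Definition closed_path F x p : Prop :=
  [/\ exact_walk x p & last x (unzip2 p) = x] /\
  [/\ 0 < size p, uniq (unzip1 p), uniq (unzip2 p) & {subset unzip1 p <= F}].

(* A path of F either extends at its last vertex or closes up: returning to an
   inner vertex would give that vertex degree 3. *)
Lemma regular_closed_path F x0 :
  (forall x, deg en F x = 2) -> exists x p, closed_path F x p.
Proof.
move=> dF; apply: contrapT => noC.
have paths n : exists x p, [/\ exact_walk x p, size p = n, uniq (unzip1 p),
    uniq (x :: unzip2 p) & {subset unzip1 p <= F}].
  elim: n => [|n [x [p [ew sp u1 u2 sF]]]]; first by exists x0, [::].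
  pose z := last x (unzip2 p).
  have cz : count_mem z (x :: unzip2 p) = 1.
    by rewrite count_uniq_mem // mem_last.
  have [f /andP[fF fp] zf] : exists2 f, (f \in F) && (f \notin unzip1 p)
      & z \in ends f.
    apply: contrapT => nof; have := dF z; rewrite (deg_seq _ _ u1 sF).
    rewrite (sum_mult_walk _ ew) [X in _ + X]big1 => [|f fFp]; last first.
      by apply/eqP; rewrite mult_eq0; apply/negP => zf; apply: nof; exists f.
    have := count_belast x p z; move: cz => /=; rewrite eqxx; lia.
  have [w fE] := ends_pair_in zf.
  have u1' : uniq (unzip1 (rcons p (f, w))).
    by rewrite /unzip1 map_rcons rcons_uniq fp.
  have ew' : exact_walk x (rcons p (f, w)).
    by rewrite exact_walk_rcons ew fE eqxx.
  have sF' : {subset unzip1 (rcons p (f, w)) <= F}.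
    by move=> g; rewrite /unzip1 map_rcons mem_rcons inE => /orP[/eqP->|/sF].
  case: (boolP (w \in x :: unzip2 p)) => wp; last first.
    exists x, (rcons p (f, w)); split=> //; first by rewrite size_rcons sp.
    by rewrite /unzip2 map_rcons -rcons_cons rcons_uniq wp.
  have wx : w \notin unzip2 p.
    have := dF w; rewrite (deg_seq _ _ u1' sF') (sum_mult_walk _ ew').
    rewrite /unzip2 map_rcons belast_rcons /= -cats1 count_cat /= eqxx.
    have := count_uniq_mem w u2; rewrite wp -has_pred1 has_count /=; lia.
  case: noC; exists x, (rcons p (f, w)); split; split=> //.
  - move: wp; rewrite /unzip2 map_rcons last_rcons inE (negPf wx) orbF.
    by move/eqP.
  - by rewrite size_rcons.
  - by rewrite /unzip2 map_rcons rcons_uniq wx; case/andP: u2.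
(* A path with [#|vert G|] edges would have one distinct vertex too many. *)
have [x [p [_ sp _ up _]]] := paths #|vert G|.
have := max_card (mem (x :: unzip2 p)).
by rewrite (card_uniqP up) /= size_map sp ltnn.
Qed.

Lemma exact_walk_ends x p f y : exact_walk x p ->
  f \in unzip1 p -> y \in ends f -> y \in x :: unzip2 p.
Proof.
elim: p x => [|[g z] p IH] x //= /andP[/eqP gE w].
rewrite inE => /orP[/eqP->|fp yf]; last by rewrite inE (IH z) // orbT.
by rewrite gE !inE => /orP[] ->; rewrite ?orbT.
Qed.

(** A closed path in [F] uses up the degree 2 of each of its vertices. No other edge of [F] touches
    it, so its vertex set is saturated and, by connectivity, contains every vertex. *)
Lemma ham_hamiltonian F : ham en F -> is_hamiltonian_cycle ([set: vert G], F).
Proof.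
case=> /card_gt0P[x0 _] dF cF; split=> //=; split; first by move=> f _ /=.
have [x [p [[ew lE] [p0 u1 u2 sF]]]] := regular_closed_path x0 dF.
have xp : x \in unzip2 p.
  by rewrite -{1}lE; case: (p) p0 => // -[e y] q _; rewrite /= mem_last.
have clos f y : f \in F -> y \in unzip2 p -> y \in ends f -> f \in unzip1 p.
  move=> fF yp yf; have := dF y; rewrite (deg_seq _ _ u1 sF).
  rewrite (sum_mult_walk _ ew).
  have := count_belast x p y; rewrite lE (count_uniq_mem _ u2) yp => E1 E2.
  have /eqP : \sum_(f in F | f \notin unzip1 p) mult en f y = 0 by lia.
  rewrite sum_nat_eq0 => /forallP/(_ f); rewrite fF /= mult_eq0 yf.
  by case: (f \in unzip1 p).
have sat : saturated en F (mem (unzip2 p)).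
  move=> f fF a b af bf /= ap.
  have := exact_walk_ends ew (clos f a fF ap af) bf.
  by rewrite inE => /orP[/eqP->|].
have allp y : y \in unzip2 p by apply: (cF _ sat x y).
exists x, p; split; split=> //.
- exact: exact_walk_is_walk.
- by apply/setP => y; rewrite !inE allp.
- apply/setP => f; rewrite inE; apply/idP/idP => [fF|/sF //].
  have [a [b fE]] := ends_pair f.
  by apply: (clos f a) => //; rewrite fE set21.
Qed.

(** The vertex set is forced to be full, so a Hamiltonian cycle is determined by its edge set. *)
Lemma num_hamiltonianE :
  num_hamiltonian G = #|[set F : {set edge G} | `[< ham en F >]]|.
Proof.
rewrite /num_hamiltonian.
have inj : injective (fun F : {set edge G} => ([set: vert G], F)).
  by move=> F F' [].
rewrite -(card_imset _ inj); apply: eq_card => -[A F]; rewrite !inE.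
apply/asboolP/imsetP => [/hamiltonian_ham[/= -> hF]|[F']].
  by exists F => //; rewrite inE; apply/asboolP.
by rewrite inE => /asboolP hF [-> ->]; apply: ham_hamiltonian.
Qed.

End Characterization.

(** * Contraction of an edge with distinct endpoints *)

Section Contraction.
Variables (G : mgraph) (e : edge G) (u v : vert G).
Hypotheses (eE : ends e = [set u; v]) (uv : u != v).
Notation en := (@ends G).
Notation cv := (@contract_vertex G e).
Notation enC := (fun f : edge G => cv @: ends f).
Implicit Types F : {set edge G}.

Lemma contract_vertex_ends x : x \in ends e -> cv x = None.
Proof. by move=> xe; rewrite /contract_vertex insubF // xe. Qed.

Lemma contract_vertexK (z : {x : vert G | x \notin ends e}) :
  cv (val z) = Some z.
Proof. exact: valK. Qed.

(** Stated additively to match [multE]; the sum is at most 1 because [u] and [v] differ. *)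
Lemma contract_vertex_eqNone x : (cv x == None) = (u == x) + (v == x) :> nat.
Proof.
rewrite /contract_vertex; case: insubP => [z + _|] /=.
  by rewrite eE !inE negb_or ![x == _]eq_sym => /andP[/negPf-> /negPf->].
rewrite negbK eE !inE ![x == _]eq_sym.
by case: (eqVneq u x) => [<- _|_ /= ->] //; rewrite eq_sym (negPf uv).
Qed.

Lemma contract_vertex_eqSome x z : (cv x == Some z) = (x == val z).
Proof.
rewrite /contract_vertex; case: insubP => [t _ <-|]; first exact: val_eqE.
by rewrite negbK; case: (x =P val z) => // -> ze; case/negP: (valP z).
Qed.

Lemma contract_vertex_onto o : exists x, cv x = o.
Proof.
case: o => [z|]; first by exists (val z); apply: contract_vertexK.
by exists u; apply: contract_vertex_ends; rewrite eE set21.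
Qed.

Lemma deg_contract_None F : deg enC F None = deg en F u + deg en F v.
Proof.
rewrite /deg -big_split; apply: eq_bigr => f _ /=.
have [a [b fE]] := ends_pair f.
have fE' : enC f = [set cv a; cv b] by rewrite /= fE imsetU1 imset_set1.
rewrite (multE _ fE') !(multE _ fE) !contract_vertex_eqNone.
by rewrite ![_ == a]eq_sym ![_ == b]eq_sym addnACA.
Qed.

Lemma deg_contract_Some F z : deg enC F (Some z) = deg en F (val z).
Proof.
rewrite /deg; apply: eq_bigr => f _.
have [a [b fE]] := ends_pair f.
have fE' : enC f = [set cv a; cv b] by rewrite /= fE imsetU1 imset_set1.
by rewrite (multE _ fE') (multE _ fE) !contract_vertex_eqSome.
Qed.

(** A set saturated for [e |: F] cannot separate [u] from [v], so it descends to the contracted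
    vertices; conversely, saturated sets pull back along [cv]. *)
Lemma connected_contract F :
  spanning_connected enC F <-> spanning_connected en (e |: F).
Proof.
split=> c A sA x y.
  have Auv : A u = A v.
    by apply/idP/idP; apply: (sA e); rewrite ?setU11 // eE ?set21 ?set22.
  (* The set induced by [A] on the contraction; its value at the merged vertex may be read at [u] as
     well as at [v]. *)
  pose B (o : option {x : vert G | x \notin ends e}) := if o is Some z then A (val z) else A u.
  have BE t : B (cv t) = A t.
    rewrite /contract_vertex; case: insubP => [z _ <- //|].
    by rewrite negbK => te; have := te; rewrite {1}eE => /set2P[] ->.
  rewrite -!BE; apply: c => f fF a b /imsetP[a' a'f ->] /imsetP[b' b'f ->].
  by rewrite !BE; apply: (sA f); rewrite ?inE ?fF ?orbT.
have [[x' <-] [y' <-]] := (contract_vertex_onto x, contract_vertex_onto y).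
apply: (c (fun t => A (cv t))) => f /setU1P[->|fF] a b af bf.
  by rewrite !contract_vertex_ends.
by apply: (sA f) => //; apply: imset_f.
Qed.

(** The degree condition shared by all the cases, which then differ only in the degrees at [u] and
    [v]. *)
Definition outer_regular F : Prop := forall x, x \notin ends e -> deg en F x = 2.

Lemma ham_contract F : ham enC F <->
  [/\ outer_regular F, deg en F u + deg en F v = 2 & spanning_connected enC F].
Proof.
split=> [[_ d c]|[d duv c]]; split=> //.
- by move=> x xe; rewrite -(deg_contract_Some F (Sub x xe)).
- by rewrite -deg_contract_None.
- by apply/card_gt0P; exists None.
- by case=> [z|]; rewrite ?deg_contract_None // deg_contract_Some d ?(valP z).
Qed.

(** Adding [e] raises the degrees of [u] and [v] by one each: this is the case of degrees (1,1). *)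
Lemma ham_edge F : e \notin F -> ham en (e |: F) <->
  [/\ outer_regular F, deg en F u = 1, deg en F v = 1 & spanning_connected enC F].
Proof.
move=> eF; have dE x : deg en (e |: F) x = (u == x) + (v == x) + deg en F x.
  by rewrite degU1 // (multE _ eE).
have [vu uu vv] : [/\ (v == u) = false, (u == u) & (v == v)].
  by rewrite !eqxx eq_sym (negPf uv).
split=> [[_ d c]|[d du dv c]]; split.
- move=> x; rewrite eE !inE negb_or ![x == _]eq_sym => /andP[/negPf xu /negPf xv].
  by have := d x; rewrite dE xu xv.
- by have := d u; rewrite dE uu vu => -[].
- by have := d v; rewrite dE vv (negPf uv) => -[].
- exact/connected_contract.
- by apply/card_gt0P; exists u.
- move=> x; rewrite dE; case: (eqVneq u x) => [<-|ux]; first by rewrite vu du.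
  case: (eqVneq v x) => [<-|vx]; first by rewrite dv.
  by rewrite d // eE !inE negb_or ![x == _]eq_sym ux vx.
- exact/connected_contract.
Qed.
End Contraction.

(** * Deletion of an endpoint *)

Section VertexDeletion.
Variables (G : mgraph) (e : edge G) (u v : vert G).
Hypotheses (eE : ends e = [set u; v]) (uv : u != v).
Notation en := (@ends G).
Notation cv := (@contract_vertex G e).
Notation enC := (fun f : edge G => cv @: ends f).
Notation enD := (fun f : edge G =>
  [set x : {x : vert G | x != u} | val x \in ends f]).
Implicit Types F : {set edge G}.

Lemma deg_del_vertex F (x : {x : vert G | x != u}) :
  (forall f, f \in F -> u \notin ends f) -> deg enD F x = deg en F (val x).
Proof.
move=> Fu; apply: eq_bigr => f /Fu; have [a [b fE]] := ends_pair f.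
rewrite fE !inE negb_or ![u == _]eq_sym => /andP[au bu].
have fE' : enD f = [set Sub a au; Sub b bu].
  by apply/setP => z; rewrite !inE /= fE !inE -!val_eqE.
by rewrite (multE _ fE') (multE _ fE) -!val_eqE.
Qed.

(** When no edge of [F] meets [u], merging [u] into [v] has the same effect as deleting [u]. *)
Lemma connected_del_vertex F : (forall f, f \in F -> u \notin ends f) ->
  spanning_connected enD F <-> spanning_connected enC F.
Proof.
move=> Fu.
have vu : v != u by rewrite eq_sym.
have outer (z : {x : vert G | x \notin ends e}) : val z != u.
  by apply: contraNneq (valP z) => ->; rewrite eE set21.
(* A bijection from the vertices of the contraction to those of the deletion, sending the merged
   vertex to [v]; its inverse is [cv] on values. *)
pose h (o : option {x : vert G | x \notin ends e}) : {x : vert G | x != u} :=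
  if o is Some z then Sub (val z) (outer z) else Sub v vu.
have hK o : cv (val (h o)) = o.
  case: o => [z|]; first exact: contract_vertexK.
  by apply: contract_vertex_ends; rewrite /= eE set22.
have cvK x : h (cv (val x)) = x.
  apply: val_inj; rewrite /contract_vertex; case: insubP => [z _ //|].
  by rewrite negbK => xe; have := xe; rewrite {1}eE !inE (negPf (valP x)) => /eqP.
split=> c A sA x y.
  rewrite -(hK x) -(hK y); apply: (c (fun t => A (cv (val t)))) => f fF a b.
  by rewrite !inE => af bf; apply: (sA f) => //; apply: imset_f.
rewrite -(cvK x) -(cvK y); apply: (c (fun o => A (h o))) => f fF.
move=> a b /imsetP[a' af ->] /imsetP[b' bf ->].
have neq t : t \in ends f -> t != u by move=> tf; apply: contraNneq (Fu f fF) => <-.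
have := (cvK (Sub a' (neq _ af)), cvK (Sub b' (neq _ bf))) => /= -[-> ->].
by apply: (sA f); rewrite ?inE.
Qed.

Lemma ham_del_vertex F :
  (F \subset [pred f | u \notin ends f]) /\ ham enD F <->
  [/\ outer_regular e F, deg en F u = 0, deg en F v = 2
    & spanning_connected enC F].
Proof.
have vu : v != u by rewrite eq_sym.
split=> [[/subsetP Fu [_ d c]]|[d /deg_eq0 Fu dv c]].
  split; [|exact/deg_eq0| |exact/connected_del_vertex].
    move=> x; rewrite eE !inE negb_or => /andP[xu _].
    by rewrite -(d (Sub x xu)) deg_del_vertex.
  by rewrite -(d (Sub v vu)) deg_del_vertex.
split; [exact/subsetP | split; last exact/connected_del_vertex].
  by apply/card_gt0P; exists (Sub v vu).
move=> x; rewrite deg_del_vertex //; case: (eqVneq (val x) v) => [->|xv] //.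
by apply: d; rewrite eE !inE negb_or (valP x) xv.
Qed.
End VertexDeletion.

(** * The counting identity for an edge with distinct endpoints *)

Lemma subset_predC1 (T : finType) (e : T) (F : {set T}) :
  (F \subset [pred f | f != e]) = (e \notin F).
Proof.
apply/subsetP/idP => [sF|eF f fF]; first by apply/negP => /sF; rewrite inE eqxx.
by apply: contraNneq eF => <-.
Qed.

(** The negative terms are moved to the left so that the identity lives in [nat] without truncated
    subtraction. *)
Lemma num_hamiltonian_contract (G : mgraph) (e : edge G) (u v : vert G) :
  ends e = [set u; v] -> u != v ->
  num_hamiltonian G + num_hamiltonian (del_vertex u)
    + num_hamiltonian (del_vertex v)
  = num_hamiltonian (del_edge e) + num_hamiltonian (contract_edge e).
Proof.
move=> eE uv; have eE' : ends e = [set v; u] by rewrite setUC.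
have vu : v != u by rewrite eq_sym.
rewrite !num_hamiltonianE.
rewrite (card_ham_val (@ends G) (fun f => f != e)).
rewrite (card_ham_val (fun f => contract_vertex e @: ends f) (fun f => f != e)).
rewrite (card_ham_val
  (fun f => [set x : {x | x != u} | val x \in ends f]) (fun f => u \notin ends f)).
rewrite (card_ham_val
  (fun f => [set x : {x | x != v} | val x \in ends f]) (fun f => v \notin ends f)).
(* Hamiltonian edge sets are split by whether they contain [e]; those that do are reindexed by
   removing [e]. *)
have -> : #|[set F : {set edge G} | `[< ham (@ends G) F >]]| =
    \sum_(F : {set edge G}) (e \notin F) && `[< ham (@ends G) F >] +
    \sum_(F : {set edge G}) (e \notin F) && `[< ham (@ends G) (e |: F) >].
  rewrite -sum1_card big_mkcond (bigID (fun F : {set edge G} => e \notin F)) /=.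
  congr (_ + _).
    rewrite big_mkcond; apply: eq_bigr => F _; rewrite inE.
    by case: (e \notin F); case: asboolP.
  rewrite [RHS](bigID (fun F : {set edge G} => e \notin F)) /=.
  rewrite [X in _ = _ + X]big1 ?addn0 => [|F /negPf-> //].
  rewrite (reindex_onto (fun F => e |: F) (fun F => F :\ e)) => [|F]; last first.
    by rewrite negbK => eF; rewrite setD1K.
  apply: eq_big => F; last first.
    by case/andP=> _ /eqP<-; rewrite !inE eqxx /=; case: asboolP.
  rewrite setU11 /=; apply/eqP/idP => [<-|eF]; first by rewrite !inE eqxx.
  exact: setU1K.
rewrite -!addnA; congr (_ + _).
  by apply: eq_bigr => F _; rewrite subset_predC1.
(* The sets avoiding [e] have cancelled against the count for [del_edge e]; what remains holds for
   each [F] separately. *)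
rewrite -!big_split /=; apply: eq_bigr => F _; rewrite subset_predC1.
pose dC := (fun f => contract_vertex e @: ends f) : edge G -> {set _}.
set q := `[< outer_regular e F /\ spanning_connected dC F >].
set du := deg (@ends G) F u; set dv := deg (@ends G) F v.
have hD a b : ends e = [set a; b] -> a != b ->
    (F \subset (fun f => a \notin ends f)) && `[< ham
      (fun f => [set x : {x | x != a} | val x \in ends f]) F >]
    = [&& q, deg (@ends G) F a == 0 & deg (@ends G) F b == 2].
  move=> abE ab.
  apply/andP/and3P => [[sF /asboolP hF]|[/asboolP[r c] /eqP d0 /eqP d2]].
    have [r d0 d2 c] := (ham_del_vertex abE ab F).1 (conj sF hF).
    by split; [apply/asboolP | apply/eqP | apply/eqP].
  have [sF hF] := (ham_del_vertex abE ab F).2 (And4 r d0 d2 c).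
  by split=> //; apply/asboolP.
rewrite (hD u v) // (hD v u) // -/du -/dv.
have -> : `[< ham dC F >] = q && (du + dv == 2).
  apply/asboolP/andP => [/(ham_contract eE uv)[r d c]|].
    by split; [apply/asboolP | apply/eqP].
  by case=> /asboolP[r c] /eqP d; apply/(ham_contract eE uv).
(* If [e] lies in [F], both endpoints have positive degree, which kills the vertex-deletion terms;
   the other terms require [e] outside [F]. *)
case: (boolP (e \in F)) => /= eF.
  have pos x : x \in ends e -> (deg (@ends G) F x == 0) = false.
    by move=> xe; apply/eqP => /deg_eq0/(_ e eF); rewrite xe.
  by rewrite /du /dv !pos ?eE ?set21 ?set22 ?andbF.
have -> : `[< ham (@ends G) (e |: F) >] = [&& q, du == 1 & dv == 1].
  apply/asboolP/and3P => [/(ham_edge eE uv eF)[r d1 d2 c]|].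
    by split; [apply/asboolP | apply/eqP | apply/eqP].
  by case=> /asboolP[r c] /eqP d1 /eqP d2; apply/(ham_edge eE uv eF).
(* The solutions of [du + dv = 2] are exactly (1,1), (0,2) and (2,0). *)
case: (q) => //=; lia.
Qed.

(** * Disjoint unions and bouquets of loops *)

Lemma num_hamiltonian_disjoint_union (G1 G2 : mgraph) :
  nonempty_graph G1 -> nonempty_graph G2 ->
  num_hamiltonian (disjoint_union G1 G2) = 0.
Proof.
case/card_gt0P=> x1 _ /card_gt0P[x2 _]; rewrite num_hamiltonianE.
apply: eq_card0 => F; rewrite inE; apply/asboolP => -[_ _ c].
(* The vertices of [G1] form a saturated set that is nonempty and proper, contradicting
   connectivity. *)
pose A (x : vert (disjoint_union G1 G2)) := if x is inl _ then true else false.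
suff sA : saturated (@ends (disjoint_union G1 G2)) F A.
  by have := c A sA (inl x1) (inr x2) isT.
by move=> [f|f] _ x y /= /imsetP[x' _ ->] /imsetP[y' _ ->].
Qed.

(** Each loop adds two to the degree of the only vertex, so degree 2 singles out the one-element
    edge sets. *)
Lemma num_hamiltonian_bouquet n : num_hamiltonian (bouquet n) = n.
Proof.
rewrite num_hamiltonianE.
suff -> : [set F : {set edge (bouquet n)} | `[< ham (@ends (bouquet n)) F >]]
    = [set F : {set 'I_n} | #|F| == 1] by rewrite card_draws card_ord bin1.
apply/setP => F; rewrite !inE.
have dE x : deg (@ends (bouquet n)) F x = #|F| * 2.
  rewrite -sum_nat_const; apply: eq_bigr => f _.
  by rewrite (@multE _ _ _ f tt tt) ?setUid //; case: x.
apply/asboolP/eqP => [[_ /(_ tt)]|F1]; first by rewrite dE; case: #|F| => [|[]].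
split=> [|x|A _ [] [] //]; first by apply/card_gt0P; exists tt.
by rewrite dE F1.
Qed.

Local Open Scope ring_scope.

Theorem theorem1 :
  (forall (G : mgraph) (e : edge G) (u v : vert G),
      ends e = [set u; v] -> u <> v ->
      (num_hamiltonian G)%:Z
      = (num_hamiltonian (del_edge e))%:Z
        + (num_hamiltonian (contract_edge e))%:Z
        - (num_hamiltonian (del_vertex u))%:Z
        - (num_hamiltonian (del_vertex v))%:Z)
  /\ (forall G1 G2 : mgraph,
      nonempty_graph G1 -> nonempty_graph G2 ->
      num_hamiltonian (disjoint_union G1 G2) = 0%N)
  /\ (forall n : nat, num_hamiltonian (bouquet n) = n).
Proof.
split=> [G e u v eE /eqP uv|]; last first.
  split; first exact: num_hamiltonian_disjoint_union.
  exact: num_hamiltonian_bouquet.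
have := num_hamiltonian_contract eE uv; lia.
Qed.
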